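(* $$\sum_{A\subseteq\mathcal{E}\ \mathrm{nice}} 2^{-|N(A)|+|B(A)|}=e^{-\Omega(d)},$$ i.e. there is an absolute constant $\kappa>0$ such that the sum is at most $e^{-\kappa d}$ for all sufficiently large $d$.
   Context: $Q_d$ is the Hamming cube on $V=\{0,1\}^d$ (adjacent iff differing in one coordinate), $\mathcal{E}$ is the set of vertices with an even number of ones. $N(A)$ is the set of vertices adjacent to some vertex of $A$, and $B(A)=\{v\in V: N(v)\subseteq A\}$. A set is $2$-linked if any two of its elements are joined by a sequence of its elements with consecutive elements at graph distance at most $2$. A fixed absolute constant $\alpha<2$ defines: $A$ is small if $|A|<\alpha^d$; $A$ is nice if it is small, $2$-linked and $|A|\ge 2$. *)

(* Defs.v *)
From mathcomp Require Import all_boot all_order all_algebra.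
From mathcomp Require Import reals.

Set Implicit Arguments.
Unset Strict Implicit.
Unset Printing Implicit Defensive.

Import Order.TTheory GRing.Theory Num.Theory.

Notation cube d := {ffun 'I_d -> bool}.

Definition adj d : rel (cube d) :=
  [rel u v : cube d | #|[set i | u i != v i]| == 1].

Definition even_vertices d : {set cube d} :=
  [set v : cube d | ~~ odd #|[set i | v i]|].

Definition nbhd d (A : {set cube d}) : {set cube d} :=
  [set v | [exists u in A, adj u v]].

Definition interior_nbhd d (A : {set cube d}) : {set cube d} :=
  [set v | nbhd [set v] \subset A].

(* Graph distance at most k: there is a walk with at most k edges. *)
Definition dist_le d (k : nat) : rel (cube d) :=
  [rel u v : cube d | [exists n : 'I_k.+1, [exists p : n.-tuple (cube d),
     path (@adj d) u p && (last u p == v)]]].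

Definition linked d (k : nat) (A : {set cube d}) : bool :=
  [forall u in A, [forall v in A,
     connect [rel x y : cube d | [&& x \in A, y \in A & dist_le k x y]] u v]].

Local Open Scope ring_scope.

Definition small (R : realType) (alpha : R) d (A : {set cube d}) : bool :=
  #|A|%:R < alpha ^+ d.

Definition nice (R : realType) (alpha : R) d (A : {set cube d}) : bool :=
  [&& small alpha A, linked 2 A & (2 <= #|A|)%N].

(* Main.v *)
Require Import Defs.
From mathcomp Require Import all_boot all_order all_algebra.
From mathcomp Require Import reals sequences exp zify lra ring.

(** Each nice [A] is encoded by a small fingerprint [U]: greedily chosen sets
    [T] in [A] and [T'] in [B(A)] such that all but a [1 / 2q] fraction of the
    neighbours of each point of [A] (resp. [B(A)]) lie in [N(T)] (resp. [N(T')]).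
    If [S] and [S'] are the sets of points with this property, then
    [N(T') <= A <= S] and [B(A) <= S'], so the sets [A] with fingerprint [U]
    number at most [2 ^ (|S| - |N(T')|)].  Edge isoperimetry in the cube gives
    [|B(A)| <= |S'| <= |N(T')|], so these sets contribute at most the largest
    value of [2 ^ (|S| - |N(A)|)], and also
    [|N(A)| - |S| >= 9 d / 8 + d |U| / (8 q ^ 2)].
    Since [A] is 2-linked, [U] is 6-linked, hence covered by a walk of [2 |U| - 2]
    steps of length at most 6; there are at most [2 ^ d (d + 1) ^ (12 (|U| - 1))]
    such [U], and summing over them leaves [2 ^ (- d / 8)]. *)

Set Implicit Arguments.
Unset Strict Implicit.
Unset Printing Implicit Defensive.

Import Order.TTheory GRing.Theory Num.Theory.

(** * Flips, adjacency and neighbourhoods in the cube *)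

Definition flip d (i : 'I_d) (v : cube d) : cube d :=
  [ffun j => (j == i) (+) v j].

Lemma flipK d (i : 'I_d) : involutive (flip i).
Proof. by move=> v; apply/ffunP=> j; rewrite !ffunE addKb. Qed.

Lemma flip_inj d (i : 'I_d) : injective (flip i).
Proof. exact: inv_inj (flipK i). Qed.

Lemma flip_dir_inj d (v : cube d) : injective (fun i => flip i v).
Proof.
move=> i j /ffunP/(_ i); rewrite !ffunE eqxx.
by case: eqP => // _; case: (v i).
Qed.

Lemma adjP d (u v : cube d) : reflect (exists i, v = flip i u) (adj u v).
Proof.
apply: (iffP cards1P) => [[i Ei]|[i ->]]; exists i.
  apply/ffunP=> j; rewrite ffunE.
  by move/setP/(_ j): Ei; rewrite !inE => <-; case: (u j) (v j) => [] [].
by apply/setP=> j; rewrite !inE ffunE; case: (u j) (j == i) => [] [].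
Qed.

Lemma nbhdP d (A : {set cube d}) v :
  reflect (exists i, flip i v \in A) (v \in nbhd A).
Proof.
rewrite inE; apply: (iffP exists_inP) => [[u uA /adjP[i ->]]|[i vA]].
  by exists i; rewrite flipK.
by exists (flip i v) => //; apply/adjP; exists i; rewrite flipK.
Qed.

Lemma flip_nbhd d (A : {set cube d}) i u : u \in A -> flip i u \in nbhd A.
Proof. by move=> uA; apply/nbhdP; exists i; rewrite flipK. Qed.

Lemma nbhdS d (A B : {set cube d}) : A \subset B -> nbhd A \subset nbhd B.
Proof.
by move=> /subsetP AB; apply/subsetP=> v /nbhdP[i /AB]; move/(flip_nbhd i); rewrite flipK.
Qed.

Lemma interior_nbhdP d (A : {set cube d}) v :
  reflect (forall i, flip i v \in A) (v \in interior_nbhd A).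
Proof.
rewrite inE; apply: (iffP subsetP) => [vA i|vA w /nbhdP[i]].
  by apply/vA/flip_nbhd/set11.
by rewrite inE => /eqP e; have := vA i; rewrite -e flipK.
Qed.

Lemma even_flip d (i : 'I_d) v :
  (flip i v \in even_vertices d) = (v \notin even_vertices d).
Proof.
rewrite !inE (cardsD1 i) [in RHS](cardsD1 i) !inE !oddD ffunE eqxx.
have -> : [set j | flip i v j] :\ i = [set j | v j] :\ i.
  by apply/setP=> j; rewrite !inE ffunE; case: eqP.
by case: (v i) (odd #|_|) => [] [].
Qed.

(** * Edge and vertex isoperimetry *)

Definition dir_edges d (W : {set cube d}) (i : 'I_d) : nat :=
  #|[set v in W | flip i v \in W]|.

Lemma leq_expn2r e m n : m <= n -> m ^ e <= n ^ e.
Proof. by case: e => // e; rewrite leq_exp2r. Qed.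

(** Split off [a ^ (a - b)]; the rest is [4ab <= (a + b) ^ 2] raised to the power [b]. *)
Lemma leq_expn_split a b :
  b <= a -> a ^ a * b ^ b * 4 ^ b <= (a + b) ^ (a + b).
Proof.
move=> ba; rewrite -mulnA -expnMn -{2}(subnK ba) expnD -mulnA -expnMn.
have {2}-> : a + b = (a - b) + 2 * b by lia.
by rewrite expnD expnM leq_mul // leq_expn2r //; nia.
Qed.

(** [dir_edges] counts each edge from both ends, so over all directions this is
    [2 e(W) <= |W| log2 |W|] without logarithms. Induct on the directions: cutting [W] along [i],
    the edges in direction [i] match points of the two halves, and edges in the other directions
    stay inside a half. *)
Lemma edge_isoperimetry d (s : seq 'I_d) (W : {set cube d}) : uniq s ->
  2 ^ (\sum_(i <- s) dir_edges W i) <= #|W| ^ #|W|.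
Proof.
elim: s W => [|i s IHs] W /=.
  by rewrite big_nil expn0 expn_gt0; case: #|W|.
case/andP=> is_ us; set C := [set v : cube d | v i].
set W1 := W :&: C; set W0 := W :\: C.
have cW : #|W| = #|W1| + #|W0| by rewrite cardsID.
have Es : \sum_(j <- s) dir_edges W j =
    \sum_(j <- s) dir_edges W1 j + \sum_(j <- s) dir_edges W0 j.
  rewrite -big_split /=; apply: eq_big_seq => j js.
  have ji : (i == j) = false by apply/negbTE/eqP=> e; rewrite e js in is_.
  rewrite /dir_edges -(cardsID C); congr (_ + _); apply: eq_card => v;
    by rewrite !inE ffunE ji; case: (v i); rewrite ?andbT ?andbF.
have Ei : dir_edges W i <= 2 * minn #|W1| #|W0|.
  have h1 : #|[set v in W | flip i v \in W] :&: C| <= minn #|W1| #|W0|.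
    rewrite leq_min; apply/andP; split.
      apply/subset_leq_card/subsetP=> v.
      by rewrite !inE => /andP[/andP[-> _] ->].
    rewrite -(card_imset _ (@flip_inj d i)).
    apply/subset_leq_card/subsetP=> _ /imsetP[v vP ->]; move: vP.
    by rewrite !inE ffunE eqxx => /andP[/andP[_ ->] ->].
  have h2 : #|[set v in W | flip i v \in W] :\: C| <= minn #|W1| #|W0|.
    rewrite leq_min; apply/andP; split; last first.
      apply/subset_leq_card/subsetP=> v.
      by rewrite !inE => /andP[-> /andP[-> _]].
    rewrite -(card_imset _ (@flip_inj d i)).
    apply/subset_leq_card/subsetP=> _ /imsetP[v vP ->]; move: vP.
    by rewrite !inE ffunE eqxx addTb => /andP[-> /andP[_ ->]].
  by rewrite /dir_edges -(cardsID C) mul2n -addnn leq_add.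
rewrite big_cons Es !expnD cW.
(* The base 4 is [2 ^ 2]: edges in direction [i] are counted twice. *)
have key : #|W1| ^ #|W1| * #|W0| ^ #|W0| * 4 ^ (minn #|W1| #|W0|)
     <= (#|W1| + #|W0|) ^ (#|W1| + #|W0|).
  case: (leqP #|W0| #|W1|) => h; first exact: leq_expn_split.
  by have := leq_expn_split (ltnW h); rewrite addnC [X in X * 4 ^ _]mulnC.
apply: leq_trans key; rewrite mulnC leq_mul //.
  by rewrite leq_mul // IHs.
by rewrite (_ : 4 = 2 ^ 2) // -expnM leq_exp2l.
Qed.

(* Double count the edges spanned by [S :|: F]: the edges between [S] and [F]
   alone number at least [(1 - 1 / 2q) d #|S|]. *)
Lemma vertex_isoperimetry d p q (S F : {set cube d}) :
  0 < d -> [disjoint S & F] ->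
  (forall u, u \in S -> 2 * q * #|[set i | flip i u \notin F]| <= d) ->
  #|S :|: F| ^ q <= 2 ^ (p * d) ->
  (2 * q - 1) * #|S| <= p * (#|S| + #|F|).
Proof.
move=> d0 SF hS hW; set W := S :|: F.
have cW : #|W| = #|S| + #|F|.
  by rewrite cardsU; move: SF; rewrite -setI_eq0 => /eqP->; rewrite cards0 subn0.
set e := \sum_(i : 'I_d) dir_edges W i.
(* For [q > 0], [hW] says [log2 |W| <= (p / q) d], so the average degree inside [W] is at most
   [(p / q) d]. *)
have he : q * e <= p * d * #|W|.
  rewrite -(@leq_exp2l 2) // mulnC expnM.
  have h1 : 2 ^ e <= #|W| ^ #|W|.
    by apply: edge_isoperimetry; exact: index_enum_uniq.
  case: (posnP q) => [->|q0]; first by rewrite expn0 expn_gt0.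
  have := h1; rewrite -(leq_exp2r _ _ q0) => h2; apply: leq_trans h2 _.
  rewrite -expnM mulnC expnM [in X in _ <= X]expnM.
  by case: (posnP #|W|) => [->//|w0]; rewrite leq_exp2r.
pose E (i : 'I_d) := #|[set u in S | flip i u \in F]|.
have hE i : 2 * E i <= dir_edges W i.
  pose X := [set u in S | flip i u \in F].
  have dX : [disjoint X & flip i @: X].
    rewrite disjoint_subset; apply/subsetP=> u; rewrite !inE => /andP[uS _].
    apply/imsetP=> [[w]]; rewrite !inE => /andP[_ wF] eu.
    by have := disjointFr SF uS; rewrite eu wF.
  rewrite mul2n -addnn -[E i]/#|X| -{2}(card_imset (mem X) (@flip_inj d i)).
  have := leq_card_setU X (flip i @: X); rewrite dX; case=> _ /eqP <-.
  apply/subset_leq_card/subsetP=> u; rewrite !inE => /orP[|/imsetP[w]].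
    by case/andP=> -> ->; rewrite orbT.
  by rewrite inE => /andP[wS wF] ->; rewrite flipK wS wF orbT.
have sE : \sum_i E i = \sum_(u in S) (d - #|[set i | flip i u \notin F]|).
  rewrite /E; under eq_bigr do rewrite -sum1_card.
  under eq_bigr do (under eq_bigl do rewrite inE; rewrite big_mkcondr /=).
  rewrite exchange_big /=; apply: eq_bigr => u uS.
  rewrite -big_mkcond sum1_card.
  have <- : #|~: [set i | flip i u \notin F]| = d - #|[set i | flip i u \notin F]|.
    by rewrite cardsCs setCK card_ord.
  by apply: eq_card=> i; rewrite !inE negbK.
have h3 : (2 * q - 1) * d * #|S| <= 2 * q * \sum_i E i.
  rewrite sE big_distrr /= mulnC -sum_nat_const leq_sum // => u uS.
  by rewrite mulnBl mul1n mulnBr leq_sub2l // hS.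
have h4 : 2 * \sum_i E i <= e by rewrite big_distrr /= leq_sum.
rewrite -(leq_pmul2r d0) -cW; nia.
Qed.

(** * Approximation by greedy covers *)

Lemma card_nbhd_leq d (A : {set cube d}) : #|nbhd A| <= d * #|A|.
Proof.
have -> : d * #|A| = #|setX [set: 'I_d] A| by rewrite cardsX cardsT card_ord.
apply: leq_trans (leq_imset_card (fun p => flip p.1 p.2) _).
apply/subset_leq_card/subsetP=> v /nbhdP[i vA].
by apply/imsetP; exists (i, flip i v); rewrite ?flipK // !inE.
Qed.

(** The inequality is strict so that, for [m > 0], every member keeps a neighbour in [nbhd T] and
    hence lies within distance 2 of [T]. *)
Definition approx d (m : nat) (T : {set cube d}) : {set cube d} :=
  [set u | m * #|[set i | flip i u \notin nbhd T]| < d].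

(* A set [T] of maximal size with the stated ratio cannot be extended by a point
   of [A] that has many neighbours outside [nbhd T]. *)
Lemma greedy_cover d m (A : {set cube d}) : 0 < d ->
  exists T : {set cube d},
    [/\ T \subset A, #|T| * d <= m * #|nbhd T| & A \subset approx m T].
Proof.
move=> d0.
pose P (T : {set cube d}) := (T \subset A) && (#|T| * d <= m * #|nbhd T|).
have P0 : P set0 by rewrite /P sub0set cards0.
case: (arg_maxnP (fun T : {set cube d} => #|T|) P0) => T /andP[TA hT] Tmax.
exists T; split=> //; apply/subsetP=> u uA; rewrite inE ltnNge; apply/negP=> hu.
have uT : u \notin T.
  apply/negP=> uT; move: hu.
  have -> : [set i | flip i u \notin nbhd T] = set0.
    by apply/setP=> i; rewrite in_set0 inE (flip_nbhd i uT).
  by rewrite cards0 muln0 leqNgt d0.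
have cN : #|nbhd T| + #|[set i | flip i u \notin nbhd T]| <= #|nbhd (u |: T)|.
  have inj : injective (fun i => flip i u) by exact: flip_dir_inj.
  rewrite -(card_imset _ inj).
  have dis : [disjoint nbhd T & [set flip i u | i in [set i | flip i u \notin nbhd T]]].
    rewrite disjoint_sym disjoint_subset; apply/subsetP=> _ /imsetP[i iP ->].
    by move: iP; rewrite inE [in X in _ -> X]inE.
  have := leq_card_setU (nbhd T) [set flip i u | i in [set i | flip i u \notin nbhd T]].
  rewrite dis; case=> _ /eqP <-.
  apply/subset_leq_card; rewrite subUset nbhdS ?subsetUr //.
  by apply/subsetP=> _ /imsetP[i _ ->]; rewrite flip_nbhd // setU11.
have : P (u |: T).
  rewrite /P subUset sub1set uA TA cardsU1 uT; nia.
by move/Tmax; rewrite /= cardsU1 uT /= add1n ltnn.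
Qed.

Lemma approx_neighbour d m (T : {set cube d}) u : 0 < m -> u \in approx m T ->
  exists i, flip i u \in nbhd T.
Proof.
move=> m0; rewrite inE => hu; apply/existsP; apply: contraLR hu.
rewrite negb_exists -leqNgt => /forallP h.
have -> : [set i | flip i u \notin nbhd T] = setT.
  by apply/setP=> i; rewrite in_setT inE h.
by rewrite cardsT card_ord leq_pmull.
Qed.

Lemma approx_sub_nbhd d m (T : {set cube d}) : 0 < m ->
  approx m T \subset nbhd (nbhd T).
Proof.
by move=> m0; apply/subsetP=> u /(approx_neighbour m0)[i ui]; apply/nbhdP; exists i.
Qed.

(** Parity makes the approximation disjoint from [F], and it lies in [nbhd F], so the union has at
    most [(d + 1) |F|] points. The parity [b] is free because both even and odd sets get
    approximated. *)
Lemma approx_isoperimetry d p q b (T F : {set cube d}) :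
  0 < d -> 0 < q ->
  {in T, forall u, (u \in even_vertices d) = b} ->
  {in F, forall u, (u \in even_vertices d) = ~~ b} ->
  nbhd T \subset F -> (d.+1 * #|F|) ^ q <= 2 ^ (p * d) ->
  (2 * q - 1) * #|approx (2 * q) T| <= p * (#|approx (2 * q) T| + #|F|).
Proof.
move=> d0 q0 hT hF TF hs; have q2 : 0 < 2 * q by lia.
apply: (@vertex_isoperimetry d) => //.
- rewrite disjoint_subset; apply/subsetP=> u /(approx_neighbour q2)[i].
  case/nbhdP=> j /hT; rewrite !even_flip negbK => ub.
  by rewrite inE; apply/negP=> /hF; rewrite ub; case: (b).
- move=> u; rewrite inE => /ltnW hu; apply: leq_trans hu.
  rewrite leq_mul2l subset_leq_card ?orbT //; apply/subsetP=> i.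
  by rewrite in_set => h; rewrite in_set; apply: contra h => /(subsetP TF).
- apply: leq_trans hs; apply: leq_expn2r; rewrite [d.+1 * _]mulSn [#|F| + _]addnC.
  apply: leq_trans (leq_card_setU _ _).1 _; rewrite leq_add2r.
  apply: leq_trans (card_nbhd_leq F).
  exact/subset_leq_card/(subset_trans (approx_sub_nbhd T q2))/nbhdS.
Qed.

(** * Lower bound for the neighbourhood of two points *)

Lemma card_nbhd1 d (u : cube d) : #|nbhd [set u]| = d.
Proof.
have inj : injective (fun i => flip i u) by exact: flip_dir_inj.
rewrite -[RHS]card_ord -cardsT -(card_imset _ inj); apply: eq_card => v.
apply/nbhdP/imsetP=> [[i]|[i _ ->]]; last by exists i; rewrite flipK set11.
by rewrite inE => /eqP <-; exists i; rewrite ?flipK.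
Qed.

(** A common neighbour [flip i u = flip j v] shows that [u] and [v] agree off [i] and [j]. One
    reached from [u] in a third direction would be reached from [v] in the same direction, forcing
    [u = v]. *)
Lemma card_nbhd_pair d (u v : cube d) : u != v ->
  #|nbhd [set u] :&: nbhd [set v]| <= 2.
Proof.
move=> uv; case: (set_0Vmem (nbhd [set u] :&: nbhd [set v])) => [->|[w]].
  by rewrite cards0.
rewrite inE => /andP[/nbhdP[i]]; rewrite inE => /eqP ui /nbhdP[j].
rewrite inE => /eqP vj.
have sub : nbhd [set u] :&: nbhd [set v] \subset [set flip i u; flip j u].
  apply/subsetP=> x; rewrite inE => /andP[/nbhdP[k]]; rewrite inE => /eqP uk /nbhdP[l].
  rewrite inE => /eqP vl.
  have xk : x = flip k u by rewrite -uk flipK.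
  rewrite xk; suff : (k == i) || (k == j).
    by case/orP=> /eqP ->; rewrite !inE eqxx ?orbT.
  apply: contraNT uv; rewrite negb_or => /andP[ki kj].
  have kl : k = l.
    have : u k = v k by rewrite -ui -vj !ffunE (negbTE ki) (negbTE kj).
    rewrite -uk -vl !ffunE eqxx; case: eqP => // _; case: (x k) => //.
  by rewrite -uk -vl kl.
apply: leq_trans (subset_leq_card sub) _; rewrite cardsU1 cards1.
by case: (_ \notin _).
Qed.

Lemma card_nbhd_ge d (A : {set cube d}) : 1 < #|A| -> 2 * d - 2 <= #|nbhd A|.
Proof.
case/card_gt1P=> u [v [uA vA uv]].
have h : #|nbhd [set u] :|: nbhd [set v]| <= #|nbhd A|.
  by apply/subset_leq_card; rewrite subUset !nbhdS ?sub1set.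
have := card_nbhd_pair uv.
move: h; rewrite cardsU !card_nbhd1; move: #|_ :&: _| #|nbhd A| => m n; lia.
Qed.

(** * Counting linked sets by covering walks *)

Lemma connect_crossing (X : finType) (e : rel X) (V : {set X}) u w :
  connect e u w -> u \in V -> w \notin V ->
  exists a b, [/\ a \in V, b \notin V & e a b].
Proof.
case/connectP=> p; elim: p u => [|y p IHp] u /=; first by move=> _ -> ->.
case/andP=> euy yp wE uV wV; case: (boolP (y \in V)) => yV.
  exact: IHp yp wE yV wV.
by exists u, y.
Qed.

Lemma mem_scanlP (X : eqType) (G : Type) (act : X -> G -> X) x l a :
  a \in x :: scanl act x l ->
  exists l1 l2, l = l1 ++ l2 /\ foldl act x l1 = a.
Proof.
elim: l x => [|g l IHl] x /=.
  by rewrite inE => /eqP ->; exists [::], [::].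
rewrite inE => /orP[/eqP ->|/IHl[l1 [l2 [-> <-]]]].
  by exists [::], (g :: l).
by exists (g :: l1), l2.
Qed.

(* Each new point is visited by a detour of length two from a neighbour already
   on the walk. *)
Lemma covering_walk (X : finType) (G : Type) (act : X -> G -> X) (e : rel X)
    (U : {set X}) n :
  (forall x y, e x y -> exists g, act x g = y) -> symmetric e ->
  {in U &, forall u v, connect [rel x y | [&& x \in U, y \in U & e x y]] u v} ->
  n < #|U| ->
  exists x l, [/\ size l = 2 * n,
    [set y in x :: scanl act x l] \subset U &
    #|[set y in x :: scanl act x l]| = n.+1].
Proof.
move=> eact esym Ucon; elim: n => [|n IHn] nU.
  case/card_gt0P: nU => x xU; exists x, [::].
  have -> : [set y in x :: scanl act x [::]] = [set x].
    by apply/setP=> y; rewrite !inE.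
  by rewrite sub1set cards1.
have [x [l [sl lU cl]]] := IHn (ltnW nU).
set V := [set y in x :: scanl act x l] in lU cl.
have xV : x \in V by rewrite inE mem_head.
have [w wU wV] : exists2 w, w \in U & w \notin V.
  apply/subsetPn; apply: contraL nU => /subset_leq_card.
  by rewrite cl -leqNgt.
have [a [b [aV bV /and3P[_ bU eab]]]] :=
  connect_crossing (Ucon _ _ (subsetP lU _ xV) wU) xV wV.
have [g gE] := eact _ _ eab; rewrite esym in eab.
have [h hE] := eact _ _ eab.
have /mem_scanlP[l1 [l2 [lE l1E]]] : a \in x :: scanl act x l.
  by move: aV; rewrite inE.
exists x, (l1 ++ [:: g, h & l2]).
have -> : [set y in x :: scanl act x (l1 ++ [:: g, h & l2])] = b |: V.
  apply/setP=> y; rewrite /V lE !inE !scanl_cat !mem_cat /= !inE l1E gE hE.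
  have yaE : (y == a) -> (y == x) || (y \in scanl act x l1) || (y \in scanl act a l2).
    move=> /eqP ->; move: aV; rewrite /V lE !inE scanl_cat mem_cat l1E.
    by rewrite orbA.
  case: (y == a) yaE => [/(_ isT)|_];
    by case: (y == b) (y == x) (y \in scanl act x l1) (y \in scanl act a l2)
      => [] [] [] [].
split.
- by move: sl; rewrite lE !size_cat /=; lia.
- by rewrite subUset sub1set bU lU.
- by rewrite cardsU1 bV cl.
Qed.

(** [None] stays put, so words of exactly [k] steps reach all distances up to [k], and there are
    [(d + 1) ^ k] of them. *)
Definition step d (v : cube d) (o : option 'I_d) : cube d :=
  if o is Some i then flip i v else v.

Definition near d k : rel (cube d) :=
  [rel u v | [exists l : k.-tuple (option 'I_d), foldl (@step d) u l == v]].

Definition near_linked d k (U : {set cube d}) : bool :=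
  [forall u in U, forall v in U,
     connect [rel x y | [&& x \in U, y \in U & near k x y]] u v].

Lemma nearP d k (u v : cube d) :
  reflect (exists l : seq (option 'I_d), size l = k /\ foldl (@step d) u l = v)
          (near k u v).
Proof.
apply: (iffP existsP) => [[l /eqP lE]|[l [/eqP sl /eqP lE]]].
  by exists l; rewrite size_tuple.
by exists (Tuple sl).
Qed.

Lemma near_refl d k (u : cube d) : near k u u.
Proof.
apply/nearP; exists (nseq k None); rewrite size_nseq; split=> //.
by elim: k => //= k ->.
Qed.

Lemma near_trans d k l (u v w : cube d) :
  near k u v -> near l v w -> near (k + l) u w.
Proof.
case/nearP=> s [<- sE] /nearP[t [<- tE]]; apply/nearP; exists (s ++ t).
by rewrite size_cat foldl_cat sE.
Qed.

Lemma near_leq d k l (u v : cube d) : k <= l -> near k u v -> near l u v.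
Proof. by move=> /subnKC <- /near_trans; apply; apply: near_refl. Qed.

Lemma near_flip d (i : 'I_d) u : near 1 u (flip i u).
Proof. by apply/nearP; exists [:: Some i]. Qed.

Lemma stepK d (o : option 'I_d) : involutive (fun v => step v o).
Proof. by case: o => [i|] v //=; rewrite flipK. Qed.

Lemma foldl_step_rev d (u : cube d) s :
  foldl (@step d) (foldl (@step d) u s) (rev s) = u.
Proof.
elim/last_ind: s => [|s o IHs] //=.
by rewrite rev_rcons foldl_rcons /= stepK.
Qed.

Lemma near_sym d k : symmetric (@near d k).
Proof.
suff h (u v : cube d) : near k u v -> near k v u.
  by move=> u v; apply/idP/idP; apply: h.
case/nearP=> s [sk sv]; apply/nearP; exists (rev s).
by rewrite size_rev -sv foldl_step_rev.
Qed.

Lemma dist_le_near d k (u v : cube d) : dist_le k u v -> near k u v.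
Proof.
case/existsP=> n /existsP[p /andP[up /eqP <-]].
apply: (@near_leq _ (size p)); first by rewrite size_tuple -ltnS ltn_ord.
case: p => p /= _ in up *; elim: p u up => [|w p IHp] u /=; first by rewrite near_refl.
by case/andP=> /adjP[i ->] /IHp; apply: near_trans (near_flip i u).
Qed.

(** Every such [U] is the visited set of some start vertex and [2n] moves, each move a word of [k]
    steps. *)
Lemma card_near_linked d k n :
  #|[set U : {set cube d} | near_linked k U && (#|U| == n.+1)]|
    <= 2 ^ d * (d.+1 ^ k) ^ (2 * n).
Proof.
pose act (x : cube d) (t : k.-tuple (option 'I_d)) := foldl (@step d) x t.
pose D := [set: cube d * (2 * n).-tuple (k.-tuple (option 'I_d))].
have -> : 2 ^ d * (d.+1 ^ k) ^ (2 * n) = #|D|.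
  by rewrite cardsT card_prod card_ffun card_bool card_ord !card_tuple card_option card_ord.
pose visited (p : cube d * (2 * n).-tuple (k.-tuple (option 'I_d))) :=
  [set y in p.1 :: scanl act p.1 p.2].
apply: leq_trans (leq_imset_card visited (mem D)).
apply/subset_leq_card/subsetP=> U; rewrite inE => /andP[Ul /eqP cU].
have [||||x [l [/eqP sl lU cl]]] := @covering_walk _ _ act (@near d k) U n.
- by move=> x y /existsP[t /eqP <-]; exists t.
- exact: near_sym.
- by move=> u v uU vU; move/forall_inP/(_ u uU)/forall_inP/(_ v vU): Ul.
- by rewrite cU.
apply/imsetP; exists (x, Tuple sl) => //=; first by rewrite inE.
by apply/esym/eqP; rewrite eqEcard lU cl cU /=.
Qed.

(** * Existence of fingerprints *)

Lemma approx_near d m (T : {set cube d}) u : 0 < m -> u \in approx m T ->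
  exists2 t, t \in T & near 2 u t.
Proof.
move=> m0 /(approx_neighbour m0)[i /nbhdP[j tT]]; exists (flip j (flip i u)) => //.
exact: near_trans (near_flip i u) (near_flip j _).
Qed.

(** Each point of [A] is within 2 of [T], so a step of length 2 in [A] becomes one of length
    [2 + 2 + 2] in [T]. A point of [T'] has a neighbour in [A], hence is within 3 of [T]. *)
Lemma near_linked_cover d m (A T T' : {set cube d}) : 0 < d -> 0 < m ->
  linked 2 A -> T \subset A -> A \subset approx m T ->
  T' \subset interior_nbhd A -> near_linked 6 (T :|: T').
Proof.
move=> d0 m0 Alink TA AT T'A; set U := T :|: T'.
set e := [rel x y | [&& x \in U, y \in U & near 6 x y]].
have TU t : t \in T -> t \in U by rewrite inE => ->.
have esym : symmetric e by move=> x y; rewrite /= near_sym andbCA.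
have csym : connect_sym e := sym_connect_sym esym.
(* Induction along a path in [A], with [s] and [t] arbitrary points of [T] near its ends. *)
have con a b s t : a \in A -> connect [rel x y | [&& x \in A, y \in A & dist_le 2 x y]] a b ->
    s \in T -> near 2 a s -> t \in T -> near 2 b t -> connect e s t.
  move=> aA /connectP[p]; elim: p a s aA => [|c p IHp] a s aA /=.
    move=> _ -> sT nas tT nat; apply: connect1; rewrite /= !TU //.
    apply: (@near_leq _ 4) => //; rewrite near_sym in nas.
    exact: near_trans nas nat.
  case/andP=> /and3P[_ cA /dist_le_near nac] cp bE sT nas tT nbt.
  have [r rT ncr] := approx_near m0 (subsetP AT _ cA).
  apply: (@connect_trans _ _ r); last exact: (IHp c).
  apply: connect1; rewrite /= !TU //= -[6]/(2 + (2 + 2)).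
  rewrite near_sym in nas; apply: near_trans nas _; exact: near_trans nac ncr.
have conT s t : s \in T -> t \in T -> connect e s t.
  move=> sT tT; have sA := subsetP TA _ sT; have tA := subsetP TA _ tT.
  apply: (con s t) => //; try exact: near_refl.
  by move/forall_inP/(_ _ sA)/forall_inP/(_ _ tA): Alink.
have conU s : s \in U -> exists2 t, t \in T & connect e s t.
  rewrite inE => /orP[sT|sT']; first by exists s => //; apply: connect0.
  have /interior_nbhdP/(_ (Ordinal d0)) aA := subsetP T'A _ sT'.
  have [t tT nat] := approx_near m0 (subsetP AT _ aA).
  have sU : s \in U by rewrite inE sT' orbT.
  exists t => //; apply: connect1; rewrite /= sU (TU t) //=.
  by apply: (@near_leq _ 3) => //; apply: near_trans (near_flip _ _) nat.
apply/forall_inP=> s /conU[s1 s1T ss]; apply/forall_inP=> t /conU[t1 t1T tt].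
apply: connect_trans ss _; apply: connect_trans (conT _ _ s1T t1T) _.
by rewrite csym.
Qed.

(* The even part [T] of [U] approximates [A] and its odd part [T'] approximates
   [interior_nbhd A]. *)
Definition fingerprint d q (A U : {set cube d}) : bool :=
  let T := U :&: even_vertices d in let T' := U :\: even_vertices d in
  [&& near_linked 6 U, 0 < #|U|,
      A \subset approx (2 * q) T, nbhd T' \subset A,
      interior_nbhd A \subset approx (2 * q) T',
      #|approx (2 * q) T'| <= #|nbhd T'| &
      8 * q ^ 2 * #|approx (2 * q) T| + 9 * q ^ 2 * d + d * #|U|
        <= 8 * q ^ 2 * #|nbhd A| ].

Lemma isoperimetry_leq q s f :
  0 < q -> (2 * q - 1) * s <= q.-1 * (s + f) -> s <= f.
Proof.
by case: q => // r _ /= h; rewrite -(@leq_pmul2l r.+1) //; lia.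
Qed.

(* The first isoperimetric bound suffices for [g >= 3 q d]; below that, the set
   is so small that the second one applies. *)
Lemma expansion_surplus d q s g u : 8 <= d -> 8 <= q ->
  (2 * q - 1) * s <= q.-1 * (s + g) ->
  (g < 3 * q * d -> (2 * q - 1) * s <= s + g) ->
  2 * d - 2 <= g -> d * u <= 4 * q * g ->
  8 * q ^ 2 * s + 9 * q ^ 2 * d + d * u <= 8 * q ^ 2 * g.
Proof.
move=> d8 q8 iso iso3 g2 du; rewrite -mulnn.
case: q q8 iso iso3 du => // r r8 iso iso3 du; rewrite /= in iso.
have {iso} sg : r.+1 * s + g <= r.+1 * g by lia.
(* With [q = r.+1], [sg] gives [8q^2 (g - s) >= 8qg]: half of this pays for [d * u], the other half
   is at least [12 q^2 d]. *)
case: (leqP (3 * r.+1 * d) g) => [hg|/iso3 hg].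
  have : 8 * r.+1 * (r.+1 * s + g) <= 8 * r.+1 * (r.+1 * g) by rewrite leq_mul2l sg orbT.
  have : 4 * r.+1 * (3 * r.+1 * d) <= 4 * r.+1 * g by rewrite leq_mul2l hg orbT.
  lia.
(* Here [2q - 2 >= 14]; below, [2d - 2 >= 7d / 4] as [d >= 8]. *)
have hs : 14 * s <= g.
  have : 7 * s <= r * s by rewrite leq_mul2r -ltnS r8 orbT.
  lia.
have hd : 7 * d <= 4 * g by lia.
have h1 : (r.+1 * r.+1) * (14 * s) <= (r.+1 * r.+1) * g by rewrite leq_mul2l hs orbT.
have h2 : (r.+1 * r.+1) * (7 * d) <= (r.+1 * r.+1) * (4 * g) by rewrite leq_mul2l hd orbT.
have h3 : (r.+1 * g) * 8 <= (r.+1 * g) * r.+1 by rewrite leq_mul2l r8 orbT.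
lia.
Qed.

(** The two size hypotheses feed vertex isoperimetry at the rates [(q - 1) / q], for every [A]
    considered, and [1 / q], for [|N(A)| < 3qd]. *)
Lemma fingerprint_exists d q (A : {set cube d}) :
  8 <= d -> 8 <= q -> A \subset even_vertices d -> linked 2 A -> 1 < #|A| ->
  (d.+1 * (d * #|A|)) ^ q <= 2 ^ (q.-1 * d) ->
  (d.+1 * (3 * q * d)) ^ q <= 2 ^ d ->
  exists U, fingerprint q A U.
Proof.
move=> d8 q8 /subsetP Aev Alink A2 Asmall dlarge.
have d0 : 0 < d by lia.
have q0 : 0 < q by lia.
have q2 : 0 < 2 * q by lia.
have [T [TA cT AT]] := greedy_cover (2 * q) A d0.
have [T' [T'B cT' BT']] := greedy_cover (2 * q) (interior_nbhd A) d0.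
have Bod v : v \in interior_nbhd A -> v \notin even_vertices d.
  by move/interior_nbhdP/(_ (Ordinal d0))/Aev; rewrite even_flip.
have Ted t : t \in T -> (t \in even_vertices d) = true.
  by move/(subsetP TA)/Aev.
have Tod t : t \in T' -> (t \in even_vertices d) = false.
  by move/(subsetP T'B)/Bod/negbTE.
have UT : (T :|: T') :&: even_vertices d = T.
  apply/setP=> v; rewrite in_setI in_setU.
  by case: (boolP (v \in T)) => [/Ted ->|_] //; case: (boolP (v \in T')) => [/Tod ->|_].
have UT' : (T :|: T') :\: even_vertices d = T'.
  apply/setP=> v; rewrite in_setD in_setU.
  case: (boolP (v \in T')) => [/Tod -> |vT']; first by rewrite orbT.
  by case: (boolP (v \in T)) => [/Ted ->|_] //=; rewrite andbF.
have NT'A : nbhd T' \subset A.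
  apply/subsetP=> v /nbhdP[i vT'].
  by have /interior_nbhdP/(_ i) := subsetP T'B _ vT'; rewrite flipK.
have cNT' : #|nbhd T'| <= #|A| := subset_leq_card NT'A.
have cN : #|nbhd A| <= d * #|A| := card_nbhd_leq A.
have Nod v : v \in nbhd A -> (v \in even_vertices d) = false.
  by case/nbhdP=> i /Aev; rewrite even_flip => /negbTE.
have iso p : (d.+1 * #|nbhd A|) ^ q <= 2 ^ (p * d) ->
    (2 * q - 1) * #|approx (2 * q) T| <= p * (#|approx (2 * q) T| + #|nbhd A|).
  by apply: (@approx_isoperimetry d p q true) => //; apply: nbhdS.
have iso' : (2 * q - 1) * #|approx (2 * q) T'|
    <= q.-1 * (#|approx (2 * q) T'| + #|nbhd T'|).
  apply: (@approx_isoperimetry d q.-1 q false) => //.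
    by move=> v /(subsetP NT'A)/Aev.
  apply: leq_trans Asmall; apply: leq_expn2r; rewrite leq_mul2l /=.
  by apply: leq_trans cNT' _; rewrite leq_pmull.
have iso1 := iso q.-1 (leq_trans (leq_expn2r _ (leq_mul (leqnn _) cN)) Asmall).
have AS : #|A| <= #|approx (2 * q) T| := subset_leq_card AT.
have cU : #|T :|: T'| <= #|T| + #|T'| := (leq_card_setU _ _).1.
have cTN : #|nbhd T| <= #|nbhd A| := subset_leq_card (nbhdS TA).
have T0 : 0 < #|T :|: T'|.
  case/card_gt1P: A2 => a [_ [/(subsetP AT)/(approx_near q2)[t tT _] _ _]].
  by apply/card_gt0P; exists t; rewrite inE tT.
have g2 := card_nbhd_ge A2.
have iso3 : #|nbhd A| < 3 * q * d ->
    (2 * q - 1) * #|approx (2 * q) T| <= #|approx (2 * q) T| + #|nbhd A|.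
  move=> /ltnW g; have := iso 1; rewrite !mul1n; apply.
  exact: leq_trans (leq_expn2r _ (leq_mul (leqnn _) g)) dlarge.
exists (T :|: T'); rewrite /fingerprint UT UT' (near_linked_cover d0 q2 Alink TA AT T'B) T0 AT NT'A BT' /=.
have hg : #|A| <= #|nbhd A| := leq_trans AS (isoperimetry_leq q0 iso1).
rewrite (isoperimetry_leq q0 iso') /=; apply: expansion_surplus => //.
(* The greedy ratios bound [d |T|] and [d |T'|] by [2q |N(A)|] each, as
   [|N(T')| <= |A| <= |N(A)|]. *)
apply: leq_trans (_ : d * (#|T| + #|T'|) <= _); first by rewrite leq_mul2l cU orbT.
have -> : 4 * q * #|nbhd A| = 2 * q * #|nbhd A| + 2 * q * #|nbhd A|.
  by rewrite -mulnDl -mulnDl.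
rewrite mulnC mulnDl leq_add // ?(leq_trans cT) ?(leq_trans cT') // leq_mul2l.
  by rewrite cTN orbT.
by rewrite (leq_trans cNT' hg) orbT.
Qed.

Local Open Scope ring_scope.

(** * Exponential decay against polynomial growth *)

Lemma geometric_sum_le (R : realFieldType) (r : R) n : 0 <= r -> r < 1 ->
  \sum_(i < n) r ^+ i <= (1 - r)^-1.
Proof.
move=> r0 r1; have r1' : 0 < 1 - r by rewrite subr_gt0.
rewrite -[leRHS]mul1r ler_pdivlMr //.
have -> : (\sum_(i < n) r ^+ i) * (1 - r) = 1 - r ^+ n.
  by rewrite -[RHS]opprB subrX1 -mulNr opprB mulrC.
by rewrite gerBl exprn_ge0.
Qed.

(** Each of the [d + 1] terms of the geometric sum up to [r ^+ d] is at least [r ^+ d]. *)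
Lemma natr_expr_le (R : realFieldType) (r : R) d : 0 <= r -> r < 1 ->
  d.+1%:R * r ^+ d <= (1 - r)^-1.
Proof.
move=> r0 r1; apply: le_trans (geometric_sum_le d.+1 r0 r1).
rewrite mulr_natl -[X in _ *+ X]card_ord -sumr_const.
by apply: ler_sum => i _; apply: ler_wiXn2l; rewrite ?(ltW r1) // -ltnS.
Qed.

Lemma expr_eventually_le (R : realType) (C r : R) : 0 <= C -> 0 <= r -> r < 1 ->
  exists d0, forall d, (d0 <= d)%N -> C * r ^+ d <= 1.
Proof.
move=> C0 r0 r1; have r1' : 0 < 1 - r by rewrite subr_gt0.
have h0 : 0 <= C / (1 - r) by rewrite divr_ge0 // ltW.
exists (Num.bound (C / (1 - r))) => d hd.
have hb : C / (1 - r) <= d.+1%:R.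
  by apply: ltW; apply: lt_le_trans (archi_boundP h0) _; rewrite ler_nat leqW.
have h := ler_wpM2l C0 (natr_expr_le d r0 r1).
rewrite -(@ler_pM2l _ d.+1%:R) ?ltr0n // mulr1 mulrCA.
exact: le_trans h hb.
Qed.

(** Write [r = s ^+ k.+1]: [k] copies of [s ^+ d] each absorb a factor [d + 1], and the last one
    absorbs the constants. *)
Lemma poly_expr_eventually_le (R : realType) (C r : R) k : 0 <= C -> 0 < r -> r < 1 ->
  exists d0, forall d, (d0 <= d)%N -> C * d.+1%:R ^+ k * r ^+ d <= 1.
Proof.
move=> C0 r0 r1; pose s := expR (ln r / k.+1%:R).
have sE : s ^+ k.+1 = r.
  by rewrite -expRM_natl mulrC divfK ?pnatr_eq0 // lnK.
have s1 : s < 1.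
  by rewrite -expR0 ltr_expR pmulr_llt0 ?invr_gt0 ?ltr0n // ln_lt0 // r0.
have s0 : 0 <= s by apply: ltW; apply: expR_gt0.
have s1' : 0 < 1 - s by rewrite subr_gt0.
have B0 : 0 <= (1 - s)^-1 by rewrite invr_ge0 ltW.
have [d0 hd0] := expr_eventually_le (mulr_ge0 C0 (exprn_ge0 k B0)) s0 s1.
exists d0 => d /hd0; apply: le_trans.
have -> : C * d.+1%:R ^+ k * r ^+ d = C * (d.+1%:R * s ^+ d) ^+ k * s ^+ d.
  rewrite -sE -exprM mulSn exprD exprMn -exprM [(d * k)%N]mulnC.
  by rewrite [s ^+ d * _]mulrC !mulrA.
rewrite ler_wpM2r ?exprn_ge0 // ler_wpM2l //.
by rewrite lerXn2r ?nnegrE ?mulr_ge0 ?exprn_ge0 // natr_expr_le.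
Qed.

(** * Summing the weights over fingerprints *)

Definition weight (R : realType) d (A : {set cube d}) : R :=
  2 ^ (- #|nbhd A|%:Z + #|interior_nbhd A|%:Z).

Lemma weightE (R : realType) d (A : {set cube d}) :
  weight R A = 2 ^+ #|interior_nbhd A| / 2 ^+ #|nbhd A|.
Proof. by rewrite /weight expfzDr ?pnatr_eq0 // exprnN mulrC. Qed.

(* The fingerprint leaves at most [2 ^ (#|S| - #|N|)] candidates for [A], where
   [N = nbhd T'] and [S = approx T], and [#|interior_nbhd A| <= #|N|]. *)
Lemma sum_fingerprint_le (R : realType) d q (y : R) (U : {set cube d}) :
  0 < y -> y <= 1 -> y ^+ (8 * q ^ 2) = 2^-1 ->
  \sum_(A : {set cube d} | fingerprint q A U) weight R A
    <= y ^+ (9 * q ^ 2 * d + d * #|U|).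
Proof.
move=> y0 y1 yE; set Y := y ^+ _.
set S := approx (2 * q) (U :&: even_vertices d).
set N := nbhd (U :\: even_vertices d).
have Y0 : 0 <= Y by rewrite exprn_ge0 // ltW.
(* A witness [A0] gives [N <= A0 <= S], so that [#|S| - #|N|] is not truncated. *)
case: (pickP (fun A : {set cube d} => fingerprint q A U)) => [A0 A0U|none]; last first.
  by rewrite big_pred0.
have NS : N \subset S.
  by case/and5P: A0U => _ _ AS NA _; apply: subset_trans NA AS.
have wle (A : {set cube d}) : fingerprint q A U -> weight R A <= 2 ^+ #|N| / 2 ^+ #|S| * Y.
  case/and5P=> _ _ _ _ /and3P[BA SN surplus]; rewrite weightE -mulrA.
  have h2 k : (2 ^+ k : R)^-1 = y ^+ (8 * q ^ 2 * k) by rewrite exprM yE exprVn.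
  rewrite ler_pM ?exprn_ge0 ?invr_ge0 ?exprn_ge0 //.
    rewrite ler_weXn2l ?ler1n //; apply: leq_trans SN; exact: subset_leq_card.
  rewrite !h2 /Y -exprD; apply: ler_wiXn2l => //; first exact: ltW.
  by rewrite addnA.
apply: le_trans (ler_sum _ wle) _.
rewrite sumr_const -[leLHS]mulr_natl mulrA.
have cF : (#|[pred A : {set cube d} | fingerprint q A U]| <= 2 ^ (#|S| - #|N|))%N.
  rewrite -(cardsDS NS) -card_powerset.
  have inj : {in [pred A : {set cube d} | fingerprint q A U] &,
      injective (fun A : {set cube d} => A :\: N)}.
    move=> A B /and5P[_ _ _ NA _] /and5P[_ _ _ NB _] e.
    by rewrite -(setID A N) -(setID B N) e (setIidPr NA) (setIidPr NB).
  rewrite -(card_in_imset inj).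
  apply/subset_leq_card/subsetP=> _ /imsetP[A AU ->].
  by case/and5P: AU => _ _ AS _ _; rewrite inE setSD.
rewrite -[leRHS]mul1r ler_wpM2r //.
have e : 2 ^+ (#|S| - #|N|) * (2 ^+ #|N| / 2 ^+ #|S|) = 1 :> R.
  by rewrite mulrA -exprD subnK ?subset_leq_card // divff // expf_neq0 // pnatr_eq0.
by rewrite -[leRHS]e ler_wpM2r ?divr_ge0 ?exprn_ge0 // -natrX ler_nat.
Qed.

(** Sets of size [n + 1] contribute at most [2 ^+ d * a * b * r ^+ n] with [r <= 1 / 2]; the
    geometric sum is at most 2, which [b <= 1 / 2] cancels. *)
Lemma sum_near_linked_le (R : realType) d k (a b : R) :
  0 <= a -> 0 <= b -> (d.+1 ^ (2 * k))%:R * b <= 2^-1 ->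
  \sum_(U : {set cube d} | near_linked k U && (0 < #|U|)%N) a * b ^+ #|U|
    <= 2 ^+ d * a.
Proof.
move=> a0 b0; set r := _ * b => r2.
have r0 : 0 <= r by rewrite mulr_ge0.
have b2 : b <= 2^-1.
  by apply: le_trans r2; rewrite ler_peMl // ler1n expn_gt0.
set M := #|{: cube d}|.
pose p (U : {set cube d}) : 'I_M.+1 := inord #|U|.-1.
rewrite (partition_big p predT) //=.
have bound (n : 'I_M.+1) :
    \sum_(U : {set cube d} | (near_linked k U && (0 < #|U|)%N) && (p U == n))
        a * b ^+ #|U| <= 2 ^+ d * a * b * r ^+ n.
  have sub (U : {set cube d}) :
      (near_linked k U && (0 < #|U|)%N) && (p U == n) ->
      U \in [set U : {set cube d} | near_linked k U && (#|U| == n.+1)].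
    case/andP=> /andP[Ul U0] /eqP pU; rewrite inE Ul /= -pU /p inordK.
      by rewrite prednK.
    by rewrite ltnS (leq_trans (leq_pred _)) // max_card.
  apply: (@le_trans _ _
    (\sum_(U in [set U : {set cube d} | near_linked k U && (#|U| == n.+1)]) a * b ^+ n.+1)).
    rewrite [leLHS]big_mkcond [leRHS]big_mkcond /=; apply: ler_sum => U _.
    case: ifPn => [/sub UP|_]; last by case: ifP => // _; rewrite mulr_ge0 ?exprn_ge0.
    by rewrite UP; move: UP; rewrite inE => /andP[_ /eqP ->].
  rewrite sumr_const -[leLHS]mulr_natl.
  have := card_near_linked d k n; rewrite -(ler_nat R) => h.
  apply: le_trans (ler_wpM2r (mulr_ge0 a0 (exprn_ge0 n.+1 b0)) h) _.
  rewrite natrM !natrX /r exprS exprMn natrX -!exprM.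
  by rewrite [(2 * k * n)%N](_ : _ = (k * (2 * n))%N) ?le_eqVlt; [apply/orP; left; apply/eqP; ring | lia].
apply: le_trans (ler_sum _ (fun n _ => bound n)) _.
rewrite -mulr_sumr -[leLHS]mulrA ler_piMr ?mulr_ge0 ?exprn_ge0 //.
have r1 : r < 1 by lra.
have h := geometric_sum_le M.+1 r0 r1.
have h2 : (1 - r)^-1 <= 2 by rewrite invf_ple ?posrE //; lra.
have : b * \sum_(i < M.+1) r ^+ i <= 2^-1 * 2.
  by rewrite ler_pM ?sumr_ge0 // => [i _|]; [rewrite exprn_ge0 | apply: le_trans h h2].
by rewrite mulVf ?pnatr_eq0.
Qed.

(** Weights are nonnegative, so counting [A] once per fingerprint only enlarges the sum. The bound
    over linked sets is applied with [k = 6] and [b = y ^+ d]. *)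
Lemma sum_weight_le (R : realType) d (P : pred {set cube d}) q (y : R) :
  0 < y -> y <= 1 -> y ^+ (8 * q ^ 2) = 2^-1 -> 2 * d.+1%:R ^+ 12 * y ^+ d <= 1 ->
  (forall A, P A -> exists U, fingerprint q A U) ->
  \sum_(A : {set cube d} | P A) weight R A <= y ^+ (q ^ 2 * d).
Proof.
move=> y0 y1 yE hd Pfp.
have w0 (A : {set cube d}) : 0 <= weight R A.
  by rewrite weightE divr_ge0 ?exprn_ge0.
apply: (@le_trans _ _ (\sum_(A : {set cube d}) \sum_(U | fingerprint q A U) weight R A)).
  rewrite [leLHS]big_mkcond /=; apply: ler_sum => A _; case: ifP => [/Pfp[U AU]|_].
    by rewrite (bigD1 U) //= lerDl sumr_ge0.
  by rewrite sumr_ge0.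
rewrite (exchange_big_dep predT) //=.
apply: (@le_trans _ _ (\sum_(U : {set cube d} | near_linked 6 U && (0 < #|U|)%N)
    y ^+ (9 * q ^ 2 * d) * (y ^+ d) ^+ #|U|)).
  rewrite [leRHS]big_mkcond /=; apply: ler_sum => U _; case: ifPn => [_|hU].
    by rewrite -exprM -exprD; apply: sum_fingerprint_le.
  rewrite big_pred0 // => A; apply: contraNF hU.
  by case/and3P=> -> ->.
apply: le_trans (sum_near_linked_le _ _ _) _; rewrite ?exprn_ge0 ?(ltW y0) //.
  by rewrite natrX -[leRHS]mulr1 ler_pdivlMl // mulrA.
(* [9 = 8 + 1]: the factor [y ^+ (8 * q ^ 2 * d)] pays for the [2 ^+ d] starting points. *)
have -> : (9 * q ^ 2 * d = 8 * q ^ 2 * d + q ^ 2 * d)%N by lia.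
by rewrite exprD exprM yE mulrA -exprMn divff ?pnatr_eq0 // expr1n mul1r.
Qed.

(** * Smallness of [A] and the choice of constants *)

Lemma small_set_expn_le (R : realType) (alpha : R) d q (A : {set cube d}) :
  0 < alpha -> (0 < q)%N -> small alpha A ->
  d.+1%:R ^+ (2 * q) * (2 * (alpha / 2) ^+ q) ^+ d <= 1 ->
  ((d.+1 * (d * #|A|)) ^ q <= 2 ^ (q.-1 * d))%N.
Proof.
move=> a0 q0 Asmall hd.
have h : (d.+1 * (d * #|A|))%:R <= d.+1%:R ^+ 2 * alpha ^+ d :> R.
  rewrite mulnA natrM ler_pM // ?(ltW Asmall) //.
  by rewrite -natrX ler_nat -mulnn leq_mul2l leqnSn orbT.
rewrite -(ler_nat R) !natrX.
apply: (@le_trans _ _ ((d.+1%:R ^+ 2 * alpha ^+ d) ^+ q)).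
  by rewrite lerXn2r ?nnegrE ?mulr_ge0 ?exprn_ge0 ?(ltW a0).
have -> : (d.+1%:R ^+ 2 * alpha ^+ d) ^+ q =
    d.+1%:R ^+ (2 * q) * (2 * (alpha / 2) ^+ q) ^+ d * 2 ^+ (q.-1 * d) :> R.
  rewrite [in LHS]exprMn -!exprM -mulrA; congr (_ * _).
  rewrite [(d * q)%N]mulnC !exprM -exprMn expr_div_n; congr (_ ^+ _).
  rewrite mulrAC -exprS prednK // mulrC divfK //.
  by rewrite expf_neq0 // pnatr_eq0.
by rewrite ler_piMl ?exprn_ge0.
Qed.

Theorem theorem4p2 (R : realType) (alpha : R)
  (alpha_gt0 : 0 < alpha) (alpha_lt2 : alpha < 2) :
  exists2 kappa : R, 0 < kappa &
  exists d0 : nat, forall d : nat, (d0 <= d)%N ->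
    \sum_(A : {set cube d} | (A \subset even_vertices d) && nice alpha A)
        (2 : R) ^ (- #|nbhd A|%:Z + #|interior_nbhd A|%:Z)
      <= expR (- kappa * d%:R).
Proof.
have ln2 : 0 < ln (2 : R) by rewrite ln_gt0 // ltr1n.
(* The final bound is [y ^+ (q ^ 2 * d)] with [y = 2 ^ (- 1 / (8 q ^ 2))], that is
   [2 ^ (- d / 8)]. *)
exists (ln 2 / 8); first by rewrite divr_gt0.
(* The constant 3 makes [rho] at most [2 / 3]. *)
have [|||q0 hq0] := @expr_eventually_le R 3 (alpha / 2); [lra|lra|lra|].
pose q := maxn 8 q0; have q8 : (8 <= q)%N := leq_maxl _ _.
have qpos : (0 < q)%N by apply: leq_trans q8.
pose rho := 2 * (alpha / 2) ^+ q.
have rho0 : 0 < rho by rewrite mulr_gt0 // exprn_gt0 // divr_gt0.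
have rho1 : rho < 1.
  by have := hq0 q (leq_maxr _ _); rewrite /rho; lra.
pose y : R := expR (- ln 2 / (8 * q ^ 2)%:R).
have y0 : 0 < y := expR_gt0 _.
have n0 : (0 < 8 * q ^ 2)%N by rewrite muln_gt0 expn_gt0 qpos.
have y1 : y < 1.
  by rewrite -expR0 ltr_expR mulNr oppr_lt0 divr_gt0 // ltr0n.
have yE : y ^+ (8 * q ^ 2) = 2^-1.
  by rewrite -expRM_natl mulrC divfK ?pnatr_eq0 -?lt0n // expRN lnK // posrE.
(* Thresholds on [d]: [d1] for isoperimetry at rate [1 / q], [d2] for rate [(q - 1) / q], [d3] for
   the sum over fingerprints. *)
have [|||d1 hd1] := @poly_expr_eventually_le R ((3 * q)%:R ^+ q) 2^-1 (2 * q);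
  [by rewrite exprn_ge0|lra|lra|].
have [d2 hd2] := poly_expr_eventually_le (2 * q) (ler01 : 0 <= 1 :> R) rho0 rho1.
have [d3 hd3] := poly_expr_eventually_le 12 (ler0n R 2) y0 y1.
exists (maxn (maxn 8 d1) (maxn d2 d3)) => d.
rewrite !geq_max => /andP[/andP[d8 /hd1 {}hd1] /andP[/hd2 {}hd2 /hd3 {}hd3]].
have -> : expR (- (ln 2 / 8) * d%:R) = y ^+ (q ^ 2 * d).
  rewrite -expRM_natl; congr expR; rewrite !natrM; field.
  by rewrite pnatr_eq0 -lt0n.
apply: (@sum_weight_le R d (fun A => (A \subset even_vertices d) && nice alpha A)) => //.
  exact: ltW.
move=> A /andP[Aev /and3P[Asmall Alink A2]].
apply: fingerprint_exists => //.
  by apply: (small_set_expn_le alpha_gt0) => //; rewrite mul1r in hd2.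
rewrite -(ler_nat R) !natrX.
apply: (@le_trans _ _ ((3 * q)%:R ^+ q * d.+1%:R ^+ (2 * q))).
  rewrite exprM -exprMn lerXn2r ?nnegrE ?mulr_ge0 ?exprn_ge0 //.
  by rewrite -natrX -natrM ler_nat -mulnn mulnCA !leq_mul2l leqnSn !orbT.
by rewrite -[leRHS]mul1r -ler_pdivrMr ?exprn_gt0 // -exprVn.
Qed.
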